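(* Let $G=(V,D,B)$ be a mixed graph and $v\in V$. Let $w_0\to v$ be an edge of $G$, and suppose that the edges $w_1\to v,\dots,w_\ell\to v\in G$ (with $\ell\ge 0$ and $w_0,\dots,w_\ell$ distinct) are generically (respectively, rationally) identifiable. Let $\bar G$ be the subgraph of $G$ obtained by removing the edges $w_0\to v,\dots,w_\ell\to v$. Suppose there are sets $S\subset V\setminus\{v\}$ and $T\subset V\setminus\{v,w_0\}$ with $|S|=|T|+1=k$ such that: (a) $\mathrm{des}(v)\cap(S\cup T\cup\{v\})=\emptyset$; (b) the maximum flow from $S$ to $T'\cup\{w_0'\}$ in $G_{\mathrm{flow}}$ equals $k$; (c) the maximum flow from $S$ to $T'\cup\{v'\}$ in $\bar G_{\mathrm{flow}}$ is smaller than $k$. Then $w_0\to v$ is generically (respectively, rationally) identifiable, by the equation $$\lambda_{w_0v}=\frac{|\Sigma_{S,T\cup\{v\}}|-\sum_{i=1}^{\ell}\lambda_{w_iv}|\Sigma_{S,T\cup\{w_i\}}|}{|\Sigma_{S,T\cup\{w_0\}}|},$$ where $\Sigma=\phi_G(\Lambda,\Omega)$ and $|\cdot|$ denotes the determinant (rows and columns ordered compatibly).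
   Context: A mixed graph $G=(V,D,B)$ on $V=\{1,\dots,n\}$ has directed edges $D\subset V\times V$ ($v\to w\in G$ iff $(v,w)\in D$) and symmetric bidirected edges $B$ ($v\leftrightarrow w\in G$ iff $(v,w)\in B$), no self-loops. $\mathrm{des}(v)$ is the set of $w$ such that there is a non-empty directed path $v\to\cdots\to w$ in $G$ (so $v\in\mathrm{des}(v)$ iff $v$ lies on a directed cycle). $\mathbb{R}^D_{\mathrm{reg}}$ is the set of real $n\times n$ matrices $\Lambda$ with $\lambda_{vw}=0$ unless $v\to w\in G$ and with $I-\Lambda$ invertible; $PD(B)$ is the set of positive definite $n\times n$ matrices $\Omega$ with $\omega_{vw}=0$ for $v\neq w$ unless $v\leftrightarrow w\in G$. Let $\Theta=\mathbb{R}^D_{\mathrm{reg}}\times PD(B)$ and $\phi_G(\Lambda,\Omega)=(I-\Lambda)^{-T}\Omega(I-\Lambda)^{-1}$. An edge $u\to w$ is generically identifiable if there is a proper algebraic subset $A\subset\Theta$ such that for all $(\Lambda,\Omega)\in\Theta\setminus A$, every $(\tilde\Lambda,\tilde\Omega)\in\Theta$ with $\phi_G(\tilde\Lambda,\tilde\Omega)=\phi_G(\Lambda,\Omega)$ satisfies $\tilde\lambda_{uw}=\lambda_{uw}$; it is rationally identifiable if there is a rational function $\psi$ and a proper algebraic subset $A\subset\Theta$ with $\psi(\phi_G(\Lambda,\Omega))=\lambda_{uw}$ for all $(\Lambda,\Omega)\in\Theta\setminus A$. For a mixed graph $H$ on $V$, $H_{\mathrm{flow}}$ is the directed graph on $\{1,\dots,n\}\cup\{1',\dots,n'\}$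 with edges $i\to j$ whenever $j\to i\in H$, $i\to i'$ for all $i$, $i\to j'$ whenever $i\leftrightarrow j\in H$, and $i'\to j'$ whenever $i\to j\in H$, with all vertices and edges of capacity $1$; for $T\subset V$, $T'=\{t':t\in T\}$. Maximum flows are with multiple sources/sinks and vertex capacities. *)

(* Defs.v *)
From HB Require Import structures.
From mathcomp Require Import all_boot all_order all_algebra.
From mathcomp Require Import reals.
From mathcomp Require Import mpoly.

Set Implicit Arguments.
Unset Strict Implicit.
Unset Printing Implicit Defensive.

Import Order.TTheory GRing.Theory Num.Theory.
Local Open Scope ring_scope.

Section MixedGraphs.
Variable n : nat.

(* A mixed graph on V = 'I_n : directed edges D (v -> w iff D v w) and
   bidirected edges B (v <-> w iff B v w). *)
Definition mixed_graph (D B : rel 'I_n) : Prop :=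
  [/\ forall i, ~~ D i i, forall i, ~~ B i i & forall i j, B i j = B j i].

Definition des (D : rel 'I_n) (v : 'I_n) : {set 'I_n} :=
  [set w | [exists u, D v u && connect D u w]].

(* The flow graph H_flow on unprimed vertices (inl i) and primed ones (inr i). *)
Definition flow_graph (D B : rel 'I_n) : rel ('I_n + 'I_n) :=
  fun x y =>
    match x, y with
    | inl i, inl j => D j i
    | inl i, inr j => (i == j) || B i j
    | inr i, inr j => D i j
    | inr _, inl _ => false
    end.

Definition prime_set (T : {set 'I_n}) : {set 'I_n + 'I_n} :=
  [set (@inr 'I_n 'I_n) t | t in T].
End MixedGraphs.

Section Flows.
Variables (R : realType) (U : finType).

(* A flow in a directed graph E with all vertex and edge capacities equal to 1,
   with multiple sources Src and sinks Snk: f is the flow on edges, a x the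
   amount injected at source x, b x the amount extracted at sink x. *)
Definition is_flow (E : rel U) (Src Snk : {set U})
    (f : U -> U -> R) (a b : U -> R) : Prop :=
  (forall x y, 0 <= f x y <= 1) /\
  (forall x y, ~~ E x y -> f x y = 0) /\
  (forall x, 0 <= a x /\ (x \notin Src -> a x = 0)) /\
  (forall x, 0 <= b x /\ (x \notin Snk -> b x = 0)) /\
  (forall x, a x + \sum_(y : U) f y x = b x + \sum_(y : U) f x y) /\
  (forall x, a x + \sum_(y : U) f y x <= 1).

Definition flow_value (Src : {set U}) (a : U -> R) : R := \sum_(x in Src) a x.

Definition max_flow_is (E : rel U) (Src Snk : {set U}) (m : R) : Prop :=
  (exists f a b, is_flow E Src Snk f a b /\ flow_value Src a = m) /\
  (forall f a b, is_flow E Src Snk f a b -> flow_value Src a <= m).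
End Flows.

Section Model.
Variables (R : realType) (n : nat).

Definition in_RDreg (D : rel 'I_n) (L : 'M[R]_n) : Prop :=
  (forall i j, ~~ D i j -> L i j = 0) /\ (1%:M - L) \in unitmx.

Definition pos_def (O : 'M[R]_n) : Prop :=
  O^T = O /\ forall x : 'cV[R]_n, x != 0 -> 0 < (x^T *m O *m x) 0 0.

Definition in_PDB (B : rel 'I_n) (O : 'M[R]_n) : Prop :=
  pos_def O /\ (forall i j, i != j -> ~~ B i j -> O i j = 0).

Definition in_Theta (D B : rel 'I_n) (th : 'M[R]_n * 'M[R]_n) : Prop :=
  in_RDreg D th.1 /\ in_PDB B th.2.

Definition phi (th : 'M[R]_n * 'M[R]_n) : 'M[R]_n :=
  (invmx (1%:M - th.1))^T *m th.2 *m invmx (1%:M - th.1).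

Definition param_coords (th : 'M[R]_n * 'M[R]_n) : 'I_(n * n + n * n) -> R :=
  fun i => match split i with
           | inl a => mxvec th.1 0 a
           | inr b => mxvec th.2 0 b
           end.

Definition mx_coords (S : 'M[R]_n) : 'I_(n * n) -> R := fun i => mxvec S 0 i.

Definition in_alg_subset (D B : rel 'I_n) (fs : seq {mpoly R[n * n + n * n]})
    (th : 'M[R]_n * 'M[R]_n) : Prop :=
  in_Theta D B th /\ all (fun f => f.@[param_coords th] == 0) fs.

Definition proper_alg_subset (D B : rel 'I_n) (fs : seq {mpoly R[n * n + n * n]}) :=
  exists th, in_Theta D B th /\ ~ in_alg_subset D B fs th.

Definition generically (D B : rel 'I_n) (P : 'M[R]_n * 'M[R]_n -> Prop) : Prop :=
  exists fs, proper_alg_subset D B fs /\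
    forall th, in_Theta D B th -> ~ in_alg_subset D B fs th -> P th.

Definition generically_identifiable (D B : rel 'I_n) (u w : 'I_n) : Prop :=
  generically D B (fun th => forall th', in_Theta D B th' ->
                      phi th' = phi th -> th'.1 u w = th.1 u w).

Definition rationally_identifiable (D B : rel 'I_n) (u w : 'I_n) : Prop :=
  exists p q : {mpoly R[n * n]},
    generically D B (fun th =>
      q.@[mx_coords (phi th)] != 0 /\
      p.@[mx_coords (phi th)] / q.@[mx_coords (phi th)] = th.1 u w).

(* Determinant of the submatrix of A with rows rs and columns cs (in the given
   orders); x0 is an irrelevant default index. *)
Definition subdet (A : 'M[R]_n) (x0 : 'I_n) (rs cs : seq 'I_n) : R :=
  \det (\matrix_(i < size rs, j < size rs) A (nth x0 rs i) (nth x0 cs j)).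
End Model.

Definition remove_edges_into (n l : nat) (D : rel 'I_n) (v w0 : 'I_n)
    (ws : 'I_l -> 'I_n) : rel 'I_n :=
  fun a b => D a b && ~~ ((b == v) && ((a == w0) || [exists i, ws i == a])).

(* Main.v *)
Require Import Defs.
From HB Require Import structures.
From mathcomp Require Import all_boot all_order all_algebra.
From mathcomp Require Import reals.
From mathcomp Require Import mpoly.
From mathcomp Require Import fingroup perm zify ring lra.
Import Order.TTheory GRing.Theory Num.Theory.
Local Open Scope ring_scope.

Set Implicit Arguments.
Unset Strict Implicit.
Unset Printing Implicit Defensive.

(** Since [des v] avoids [v], [S] and [T], deleting the edges [w_i -> v] changes
    Sigma on the rows [S] and columns [T + v] only in the column [v], from which
    it subtracts [sum_i lambda_(w_i v) Sigma_(., w_i)]. By (c) the corresponding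
    minor of the smaller graph vanishes, which is the linear equation for
    [lambda_(w0 v)]; by (b) its leading coefficient is generically nonzero.

    Flows and minors are compared through permutations: bordering the weighted
    flow graph matrix by the source and sink indicators gives a matrix whose
    determinant is, up to a unit, the minor of Sigma. A nonzero Leibniz term is
    an integral flow of full value; conversely a fractional flow of full value is
    a fractional perfect matching of the bordered matrix, so Hall's theorem
    yields a permutation in its support. From such a permutation one reads off
    a left and a right system of disjoint paths, and parameters with a nonzero
    minor are found by factoring the minor into a left and a right part. *)

(** * Hall's theorem and fractional matchings *)

Section Hall.
Variables X Y : finType.
Implicit Types (N : {ffun X -> {set Y}}) (A : {set X}).

Let nbh N A : {set Y} := \bigcup_(x in A) N x.
Let hall_cond N := forall A : {set X}, (#|A| <= #|nbh N A|)%N.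
Let shrink N x y : {ffun X -> {set Y}} :=
  [ffun z => if z == x then N z :\ y else N z].

(** A violating set of the shrunken family must contain [x], as no other neighbourhood has changed;
    deleting [x] from it gives [A]. *)
Let shrink_violation N x y : hall_cond N -> ~ hall_cond (shrink N x y) ->
  exists2 A : {set X}, x \notin A & (#|N x :\ y :|: nbh N A| <= #|A|)%N.
Proof.
move=> hN hs; have [A hA] : exists A : {set X}, (#|nbh (shrink N x y) A| < #|A|)%N.
  case: (pickP [pred A : {set X} | (#|nbh (shrink N x y) A| < #|A|)%N]) => [A|none].
    by exists A.
  by case: hs => A; have := none A; rewrite /= ltnNge => /negbFE.
have xA : x \in A.
  apply/negPn/negP => xA; move: hA; rewrite ltnNge (leq_trans (hN A))//.
  apply/subset_leq_card/bigcupsP => z zA.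
  apply/(subset_trans _ (bigcup_sup z zA)); rewrite ffunE.
  by case: eqP => // zx; rewrite -zx zA in xA.
exists (A :\ x); first by rewrite !inE eqxx.
rewrite (cardsD1 x A) xA ltnS in hA; apply: leq_trans hA.
apply: subset_leq_card; rewrite subUset; apply/andP; split.
  by apply: (subset_trans _ (bigcup_sup x xA)); rewrite ffunE eqxx.
apply/bigcupsP => z; rewrite !inE => /andP[zx zA].
by apply: (subset_trans _ (bigcup_sup z zA)); rewrite ffunE (negPf zx).
Qed.

(* Rado's argument: if deleting y1 and deleting y2 from N x both break the
   condition, submodularity of cardinality contradicts it for N itself. *)
Let hall_shrink N x y1 y2 : hall_cond N -> y1 != y2 ->
  hall_cond (shrink N x y1) \/ hall_cond (shrink N x y2).
Proof.
move=> hN y12.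
have dec N' : hall_cond N' \/ ~ hall_cond N'.
  case: (boolP [forall A : {set X}, (#|A| <= #|nbh N' A|)%N]) => [/forallP|/forallP]; by [left|right].
case: (dec (shrink N x y1)) => [|h1]; first by left.
case: (dec (shrink N x y2)) => [|h2]; first by right.
exfalso.
have [A1 x1 c1] := shrink_violation hN h1; have [A2 x2 c2] := shrink_violation hN h2.
set P1 := _ :|: _ in c1; set P2 := _ :|: _ in c2.
(* Since [y1] and [y2] differ, [P1] and [P2] together cover [N x]; adding [x] to the union gains one
   element on the left. *)
have cU : (#|A1 :|: A2| < #|P1 :|: P2|)%N.
  have -> : (#|A1 :|: A2|.+1 = #|x |: (A1 :|: A2)|)%N.
    by rewrite cardsU1 !inE negb_or x1 x2.
  apply: (leq_trans (hN _)); apply/subset_leq_card/bigcupsP => z.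
  rewrite !inE => /or3P[/eqP->|zA|zA].
  - apply/subsetP => y yx; rewrite !inE yx !andbT.
    by case: eqP => //= ->; rewrite y12 orbT.
  - apply/(subset_trans (bigcup_sup z zA)).
    by apply/(subset_trans (subsetUr (N x :\ y1) _))/subsetUl.
  - apply/(subset_trans (bigcup_sup z zA)).
    by apply/(subset_trans (subsetUr (N x :\ y2) _))/subsetUr.
have cI : (#|A1 :&: A2| <= #|P1 :&: P2|)%N.
  apply: (leq_trans (hN _)); apply/subset_leq_card/bigcupsP => z.
  rewrite inE => /andP[z1 z2]; rewrite subsetI; apply/andP; split.
    exact/(subset_trans (bigcup_sup z z1))/subsetUr.
  exact/(subset_trans (bigcup_sup z z2))/subsetUr.
have := cardsUI A1 A2; have := cardsUI P1 P2; lia.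
Qed.

(** Induction on the total size of the neighbourhoods: one with two elements can be shrunk, and once
    all are singletons the condition on pairs makes the choice injective. *)
Lemma hall (E : X -> Y -> bool) :
  (forall A : {set X}, (#|A| <= #|[set y | [exists x in A, E x y]]|)%N) ->
  exists g : X -> Y, injective g /\ forall x, E x (g x).
Proof.
move=> hE.
suff key m N : (\sum_x #|N x| <= m)%N -> hall_cond N ->
    exists g : X -> Y, injective g /\ forall x, g x \in N x.
  pose N := [ffun x => [set y | E x y]].
  have hN : hall_cond N.
    move=> A; apply: leq_trans (hE A) _; apply/subset_leq_card/subsetP => y.
    rewrite inE => /existsP[x /andP[xA Exy]]; apply/bigcupP; exists x => //.
    by rewrite ffunE inE.
  have [g [gi gE]] := key _ N (leqnn _) hN.
  by exists g; split => // x; have := gE x; rewrite ffunE inE.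
elim: m N => [|m IH] N.
  move=> s0 hN; have nX (x : X) : False.
    have := hN [set x]; rewrite /nbh big_set1 cards1; move: s0.
    by rewrite (bigD1 x)//=; lia.
  by exists (fun x => False_rect _ (nX x)); split => x; case: (nX x).
move=> sm hN.
case: (pickP [pred x | (1 < #|N x|)%N]) => [x /= /card_gt1P[y1 [y2 [yN1 yN2 y12]]]|small].
  have step y : y \in N x -> hall_cond (shrink N x y) ->
      exists g : X -> Y, injective g /\ forall x, g x \in N x.
    move=> yN /(IH _ _)[|g [gi gN]].
      rewrite -ltnS; apply: leq_trans sm; rewrite (bigD1 x)//= [X in (_ < X)%N](bigD1 x)//=.
      rewrite ffunE eqxx (cardsD1 y (N x)) yN addSn ltnS leq_add2l.
      by apply: eq_leq; apply: eq_bigr => z zx; rewrite ffunE (negPf zx).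
    exists g; split => // z; have := gN z; rewrite ffunE.
    by case: eqP => // _; rewrite inE => /andP[].
  by case: (hall_shrink x hN y12); apply: step.
have N1 x : exists y, N x == [set y].
  suff [y ->] : exists y, N x = [set y] by exists y.
  apply/cards1P; have /= := small x; have := hN [set x].
  by rewrite /nbh big_set1 cards1; lia.
exists (fun x => xchoose (N1 x)).
have Ng x : N x = [set xchoose (N1 x)] by apply/eqP/(xchooseP (N1 x)).
split=> [x1 x2 eg|x]; last by rewrite {2}Ng inE.
apply/eqP/negPn/negP => x12; have := hN [set x1; x2].
rewrite cards2 x12 /nbh bigcup_setU !big_set1 Ng (Ng x2) eg setUid cards1.
by [].
Qed.
End Hall.

(** Double counting gives Hall's condition: the rows in [A] have total mass [#|A|], all of it in
    columns of [N], each holding at most 1. *)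
Lemma fractional_matching (R : realFieldType) (X Y : finType) (m : X -> Y -> R) :
  (forall x y, 0 <= m x y) -> (forall x, \sum_y m x y = 1) ->
  (forall y, \sum_x m x y <= 1) ->
  exists g : X -> Y, injective g /\ forall x, 0 < m x (g x).
Proof.
move=> m0 mrow mcol; apply: (hall (E := fun x y => 0 < m x y)) => A; set N := finset _.
rewrite -(ler_nat R) -!sumr_const -(eq_bigr _ (fun x _ => mrow x)).
have -> : \sum_(x in A) \sum_y m x y = \sum_(x in A) \sum_(y in N) m x y.
  apply: eq_bigr => x xA; rewrite (bigID (mem N))/= [X in _ + X]big1 ?addr0//.
  move=> y; rewrite inE negb_exists => /forallP/(_ x); rewrite xA/= -leNgt => mxy.
  by apply/eqP; rewrite eq_le mxy m0.
rewrite exchange_big; apply: ler_sum => y _; apply: le_trans (mcol y).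
by rewrite [X in _ <= X](bigID (mem A))/= lerDl sumr_ge0.
Qed.

(** * Flows of full value and systems of disjoint paths *)

Section Linkings.
Variables (U K : finType).

(* A system of vertex-disjoint E-paths from s to t, together with disjoint
   E-cycles, is encoded as a permutation of U + K: each vertex goes to its
   successor, vertices off the system are fixed, the end t b of a path goes to
   the marker b, and the marker a goes to the starting point s a. *)
Definition link_rel (E : rel U) (s t : K -> U) : rel (U + K) :=
  fun x y => match x, y with
  | inl i, inl j => (i == j) || E i j
  | inl i, inr b => i == t b
  | inr a, inl j => j == s a
  | inr _, inr _ => false
  end.

Definition linked (E : rel U) (s t : K -> U) : Prop :=
  exists g : U + K -> U + K, injective g /\ forall x, link_rel E s t x (g x).

Variables (R : realType) (E : rel U) (s t : K -> U).
Hypotheses (s_inj : injective s) (t_inj : injective t).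

Lemma flow_linked f a b : is_flow (R := R) E [set s x | x : K] [set t x | x : K] f a b ->
  flow_value [set s x | x : K] a = #|K|%:R -> linked E s t.
Proof.
move=> [f01 [fE [ha [hb [cons cap]]]]]; rewrite /flow_value => val.
pose thru x := a x + \sum_y f y x.
have f0 x y : 0 <= f x y by case/andP: (f01 x y).
have a1 x : a x <= 1.
  by apply: le_trans (cap x); rewrite lerDl sumr_ge0.
(* Full value forces every source to be saturated. *)
have as1 c : a (s c) = 1.
  apply/eqP; rewrite eq_le a1/=.
  have sc : s c \in [set s x | x : K] by apply: imset_f.
  move: val; rewrite (bigD1 (s c))//= => val.
  have : \sum_(i in [set s x | x : K] | i != s c) a i <= (#|K|.-1)%:R.
    have -> : #|K|.-1 = #|[set s x | x : K] :\ s c|%N.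
      by move: (cardsD1 (s c) [set s x | x : K]); rewrite sc card_imset// => ->.
    rewrite -sumr_const; rewrite (eq_bigl (mem ([set s x | x : K] :\ s c))).
      by apply: ler_sum => i _.
    by move=> i; rewrite !inE andbC.
  have K0 : (0 < #|K|)%N by apply/card_gt0P; exists c.
  by have := natrD R 1 #|K|.-1; rewrite add1n prednK//; lra.
pose m (x y : U + K) : R := match x, y with
  | inl i, inl j => f i j + (i == j)%:R * (1 - thru i)
  | inl i, inr c => (i == t c)%:R * b i
  | inr c, inl j => (j == s c)%:R
  | inr _, inr _ => 0 end.
have dirac (T : finType) (i : T) (F : T -> R) : \sum_j (i == j)%:R * F j = F i.
  rewrite (bigD1 i)//= eqxx mul1r big1 ?addr0// => j.
  by rewrite eq_sym => /negPf->; rewrite mul0r.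
have [|||g [gi gm]] := @fractional_matching R _ _ m.
- move=> [i|c] [j|d] //=.
    by rewrite addr_ge0// mulr_ge0// subr_ge0 cap.
  by rewrite mulr_ge0//; case: (hb i).
- move=> [i|c]; rewrite big_sumType/=.
    rewrite big_split/= dirac.
    suff -> : \sum_c (i == t c)%:R * b i = b i by rewrite /thru cons; ring.
    case: (boolP (i \in [set t x | x : K])) => [/imsetP[c _ ->]|hi].
      rewrite (bigD1 c)//= eqxx mul1r big1 ?addr0// => d dc.
      by rewrite (inj_eq t_inj) eq_sym (negPf dc) mul0r.
    case: (hb i) => _ /(_ hi) ->.
    by rewrite big1// => c _; rewrite mulr0.
  rewrite [X in _ + X]big1// addr0 (bigD1 (s c))//= eqxx big1 ?addr0// => j.
  by move/negPf => ->.
- move=> [j|d]; rewrite big_sumType/=.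
    rewrite big_split/=.
    under [X in _ + X + _]eq_bigr do rewrite eq_sym.
    rewrite (dirac _ j (fun x => 1 - thru x)) /thru.
    suff : \sum_c (j == s c)%:R <= a j by lra.
    case: (boolP (j \in [set s x | x : K])) => [/imsetP[c _ ->]|hj].
      rewrite as1 (bigD1 c)//= eqxx big1 ?addr0// => d dc.
      by rewrite (inj_eq s_inj) eq_sym (negPf dc).
    rewrite big1; first by case: (ha j).
    move=> c _; case: eqP => // jc.
    by move: hj; rewrite jc imset_f.
  rewrite [X in _ + X]big1// addr0.
  under eq_bigr do rewrite eq_sym.
  rewrite dirac; apply: le_trans (cap (t d)); rewrite cons lerDl sumr_ge0//.
exists g; split => // x; have := gm x.
case: x => [i|c]; case: (g _) => [j|d] /=.
- case: eqP => //= _; rewrite mul0r addr0; apply: contraTT => /fE ->.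
  by rewrite ltxx.
- by case: eqP => //; rewrite mul0r ltxx.
- by case: eqP => //; rewrite ltxx.
- by rewrite ltxx.
Qed.

Lemma linked_flow : linked E s t -> exists f a b,
  is_flow (R := R) E [set s x | x : K] [set t x | x : K] f a b /\
  flow_value [set s x | x : K] a = #|K|%:R.
Proof.
move=> [g [gi gE]].
have gs c : g (inr c) = inl (s c).
  by have := gE (inr c); case: (g _) => //= j /eqP->.
pose h := invF gi; have hK : cancel h g := f_invF gi.
have ht c : h (inr c) = inl (t c).
  have := gE (h (inr c)); rewrite hK; case: (h _) => //= i /eqP->//.
have gt c : g (inl (t c)) = inr c by rewrite -ht hK.
(* The test [x != y] discards the fixed vertices, which would otherwise carry flow on loops. *)
exists (fun x y => ((x != y) && (g (inl x) == inl y))%:R).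
exists (fun x => (x \in [set s x | x : K])%:R).
exists (fun x => (x \in [set t x | x : K])%:R).
(* The throughput of a vertex, computed from its inflow or its outflow, is 1 exactly when [g] moves
   it; this gives both conservation and capacity. *)
pose moved x : R := (g (inl x) != inl x)%:R.
have ein x : (x \in [set s x | x : K])%:R
    + \sum_y ((y != x) && (g (inl y) == inl x))%:R = moved x.
  rewrite /moved; have := hK (inl x); case: (h _) => [y|c] gy; last first.
    have -> : x = s c by move: gy; rewrite gs => -[].
    rewrite imset_f// big1 ?addr0; last first.
      by move=> y _; rewrite -gs (inj_eq gi) andbF.
    suff -> : g (inl (s c)) != inl (s c) by [].
    by apply/eqP; rewrite -gs => /gi; rewrite gs.
  have -> : (x \in [set s x | x : K]) = false.
    by apply/negP => /imsetP[c _ xc]; move: gy; rewrite xc -gs => /gi.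
  rewrite add0r (bigD1 y)//= gy eqxx andbT big1 ?addr0.
    by rewrite -gy (inj_eq gi) gy (inj_eq inl_inj) eq_sym.
  move=> z zy; rewrite -gy (inj_eq gi) (inj_eq inl_inj).
  by rewrite (negPf zy) andbF.
have eout x : (x \in [set t x | x : K])%:R
    + \sum_y ((x != y) && (g (inl x) == inl y))%:R = moved x.
  rewrite /moved; case: (boolP (x \in _)) => [/imsetP[c _ ->]|xt].
    by rewrite gt big1 ?addr0// => y _; rewrite andbF.
  case gx: (g (inl x)) => [y|c]; last first.
    by case/negP: xt; have := gE (inl x); rewrite gx => /eqP->; rewrite imset_f.
  rewrite add0r (bigD1 y)//= eqxx andbT big1 ?addr0.
    by rewrite (inj_eq inl_inj) eq_sym.
  by move=> z zy; rewrite (inj_eq inl_inj) [y == z]eq_sym (negPf zy) andbF.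
split; last first.
  rewrite /flow_value (eq_bigr (fun=> 1)) => [|x ->//].
  by rewrite sumr_const card_imset.
split; first by move=> x y; rewrite ler0n lern1 leq_b1.
split.
  move=> x y nE; case: eqP => //= /eqP xy; case: eqP => // gx.
  by have := gE (inl x); rewrite gx/= (negPf nE) (negPf xy).
split; first by move=> x; split => [|/negPf->]//; rewrite ler0n.
split; first by move=> x; split => [|/negPf->]//; rewrite ler0n.
split => x; first by rewrite ein eout.
by rewrite ein lern1 leq_b1.
Qed.
End Linkings.

(** * Polynomial dependence of determinants, and bordered determinants *)

Lemma poly_nonroot (R : realFieldType) (p : {poly R}) (e : R) :
  p != 0 -> 0 < e -> exists2 u, 0 < u < e & p.[u] != 0.
Proof.
(* These points are distinct and lie strictly between 0 and [e] (hence [i.+2]); [size p] of them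
   cannot all be roots. *)
move=> p0 e0; pose pt i : R := e / (i.+2)%:R.
have pt_inj : injective pt.
  move=> i j; rewrite /pt => /(mulfI (lt0r_neq0 e0))/invr_inj/eqP.
  by rewrite eqr_nat !eqSS => /eqP.
pose rs := [seq pt i | i <- iota 0 (size p)].
have : ~~ all (root p) rs.
  apply/negP => /(max_poly_roots p0).
  rewrite map_inj_uniq// iota_uniq size_map size_iota ltnn.
  by move/(_ isT).
move=> /allPn[u /mapP[i _ ->] ru]; exists (pt i) => //.
by rewrite divr_gt0//= ltr_pdivrMr// ltr_pMr// ltr1n.
Qed.

Section Determinants.
Variable F : fieldType.

Lemma det_affine m (A B : 'M[F]_m) :
  exists p : {poly F}, forall u, \det (A + u *: B) = p.[u].
Proof.
exists (\det (map_mx polyC A + 'X *: map_mx polyC B)) => u.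
rewrite -[RHS]/(horner_eval u _) -det_map_mx; congr (\det _).
by apply/matrixP => i j; rewrite !mxE /= /horner_eval !hornerE.
Qed.

Lemma det_addr_scalar m (A : 'M[F]_m) :
  exists2 p : {poly F}, p != 0 & forall u, \det (A + u%:M) = p.[u].
Proof.
exists (char_poly (- A)); first exact/monic_neq0/char_poly_monic.
move=> u; rewrite /char_poly -[RHS]/(horner_eval u _) -det_map_mx.
congr (\det _); apply/matrixP => i j.
by rewrite !mxE /= /horner_eval !hornerE hornerMn hornerX opprK addrC.
Qed.

(** Block elimination of [N]: the second factor is the Schur complement, and the sign of [- Z]
    cancels its minus sign. *)
Lemma det_border n k (N : 'M[F]_n) (X : 'M_(n, k)) (Z : 'M_(k, n)) :
  N \in unitmx ->
  \det (block_mx N X (- Z) 0) = \det N * \det (Z *m invmx N *m X).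
Proof.
move=> uN.
have -> : block_mx N X (- Z) 0 =
    block_mx N 0 (- Z) (Z *m invmx N *m X) *m block_mx 1%:M (invmx N *m X) 0 1%:M.
  rewrite mulmx_block !mulmx1 !mulmx0 !addr0 mulmxA mulmxV// mul1mx.
  by rewrite mulNmx mulmxA addNr.
by rewrite det_mulmx det_lblock det_ublock !det1 !mulr1.
Qed.

(** Puts a minor of an inverse into the shape [Z *m invmx N *m X] of [det_border]. *)
Lemma mxsub_mulmx m n k l (f : 'I_k -> 'I_m) (g : 'I_l -> 'I_n) (A : 'M[F]_(m, n)) :
  mxsub f g A = rowsub f 1%:M *m A *m colsub g 1%:M.
Proof.
rewrite mulmx_colsub mulmx1 mul_rowsub_mx mul1mx.
by apply/matrixP => i j; rewrite !mxE.
Qed.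

(** The bordered determinant is nonzero, so some Leibniz term is; its permutation, read through
    [split], is the linking. *)
Lemma minor_linked m k (N : 'M[F]_m) (E : rel 'I_m) (s t : 'I_k -> 'I_m) :
  N \in unitmx -> (forall x y, x != y -> N x y != 0 -> E x y) ->
  \det (mxsub s t (invmx N)) != 0 -> linked E s t.
Proof.
move=> uN NE d0; pose M := block_mx N (colsub t 1%:M) (- rowsub s 1%:M) 0.
have : \det M != 0.
  by rewrite det_border// -mxsub_mulmx mulf_neq0// -unitfE -unitmxE.
case: (pickP [pred sg : 'S_(m + k) | \prod_i M i (sg i) != 0]) => [sg /= sg0 _|none]; last first.
  rewrite /determinant big1 ?eqxx// => sg _.
  by have := none sg; rewrite /= => /negbFE/eqP->; rewrite mulr0.
have sg1 i : M i (sg i) != 0 by move/prodf_neq0: sg0; apply.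
exists (fun x => split (sg (unsplit x))); split.
  move=> x y /(can_inj (@splitK m k))/perm_inj.
  exact: (can_inj (@unsplitK m k)).
move=> x; have := sg1 (unsplit x); rewrite -{1}[sg _]splitK.
case: x (split _) => [i|c] [j|d] /=.
- rewrite /M block_mxEul => Nij; case: (eqVneq i j) => //= ij.
  exact: NE.
- by rewrite block_mxEur !mxE; case: (i =P t d); rewrite ?eqxx.
- by rewrite block_mxEdl !mxE [s c == j]eq_sym; case: (j =P s c); rewrite ?mulr0n ?oppr0 ?eqxx.
- by rewrite block_mxEdr mxE eqxx.
Qed.
End Determinants.

Lemma linked_bij (U U' K : finType) (E : rel U) (E' : rel U') (s t : K -> U)
    (h : U -> U') (h' : U' -> U) :
  cancel h h' -> cancel h' h -> (forall x y, E x y -> E' (h x) (h y)) ->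
  linked E s t -> linked E' (h \o s) (h \o t).
Proof.
move=> hK h'K hE [g [gi gE]].
pose lift (V V' : Type) (f : V -> V') (x : V + K) : V' + K :=
  match x with inl u => inl (f u) | inr c => inr c end.
exists (lift _ _ h \o g \o lift _ _ h'); split.
  have lK : cancel (lift _ _ h) (lift _ _ h') by case=> //= u; rewrite hK.
  have l'K : cancel (lift _ _ h') (lift _ _ h) by case=> //= u; rewrite h'K.
  by apply: inj_comp (can_inj l'K); apply: inj_comp gi; apply: can_inj lK.
move=> [x|c] /=.
  have := gE (inl (h' x)); case: (g _) => [y|d] /=.
    by case/orP => [/eqP<-|/hE]; rewrite h'K ?eqxx// => ->; rewrite orbT.
  by move/eqP <-; rewrite h'K.
have := gE (inr c); case: (g _) => [y|d] //= /eqP->.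
by rewrite eqxx.
Qed.

(** * The matrix Sigma and the flow graph *)

Section TrekMatrix.
Variables (F : fieldType) (n : nat).
Implicit Types L O : 'M[F]_n.

Definition sigma L O : 'M[F]_n :=
  (invmx (1%:M - L))^T *m O *m invmx (1%:M - L).

(* Sigma is the upper right block of the inverse of the weighted flow graph
   matrix [[(I - L)^T, -O], [0, I - L]]. *)
Lemma sigma_minor_linked k (D B : rel 'I_n) L O (s t : 'I_k -> 'I_n) :
  1%:M - L \in unitmx -> (forall i j, ~~ D i j -> L i j = 0) ->
  (forall i j, i != j -> ~~ B i j -> O i j = 0) ->
  \det (mxsub s t (sigma L O)) != 0 ->
  linked (flow_graph D B) (inl \o s) (inr \o t).
Proof.
move=> uL LD OB; set A := 1%:M - L in uL *.
pose N := block_mx A^T (- O) 0 A.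
pose P := block_mx (invmx A)^T (sigma L O) 0 (invmx A).
have NP : N *m P = 1%:M.
  rewrite mulmx_block !mul0mx !mulmx0 !addr0 !add0r -trmx_mul mulVmx// mulmxV//.
  rewrite /sigma -/A !mulmxA -trmx_mul mulVmx// trmx1 mul1mx mulNmx subrr.
  by rewrite -scalar_mx_block.
have uN : N \in unitmx by case/mulmx1_unit: NP.
have invN : invmx N = P by rewrite -[LHS]mulmx1 -NP mulmxA mulVmx// mul1mx.
pose E (x y : 'I_(n + n)) := flow_graph D B (split x) (split y).
have -> : mxsub s t (sigma L O) = mxsub (lshift n \o s) (@rshift n n \o t) (invmx N).
    rewrite invN; apply/matrixP => i j.
    by rewrite [LHS]mxE [RHS]mxE /= block_mxEur.
move=> /minor_linked-/(_ E uN) lk.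
have {}lk : linked E (lshift n \o s) (@rshift n n \o t).
  apply: lk => x y; rewrite /E -{1 2}[x]splitK -{1 2}[y]splitK.
  case: (split x) (split y) => [i|i] [j|j] /=.
  - rewrite block_mxEul !mxE (inj_eq (@lshift_inj _ _)) => ij.
    rewrite [j == i]eq_sym (negPf ij) sub0r oppr_eq0.
    by apply: contraNT => /LD->.
  - rewrite block_mxEur !mxE oppr_eq0 => _; apply: contraNT.
    by rewrite negb_or => /andP[ij /(OB _ _ ij)->].
  - by rewrite block_mxEdl mxE eqxx.
  - rewrite block_mxEdr !mxE (inj_eq (@rshift_inj _ _)) => ij.
    rewrite (negPf ij) sub0r oppr_eq0.
    by apply: contraNT => /LD->.
have /= [g [gi gE]] := linked_bij (@splitK n n) (@unsplitK n n) (fun x y (e : E x y) => e) lk.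
exists g; split => // x; have := gE x.
by case: x (g _) => [x|c] [y|d] //=; rewrite ?(unsplitK (inl _)) ?(unsplitK (inr _)).
Qed.
End TrekMatrix.

(** * Parameters with a nonzero minor, built from path systems *)

Lemma mulmx1_invmx (F : fieldType) n (A B : 'M[F]_n) :
  A *m B = 1%:M -> A \in unitmx /\ invmx A = B.
Proof.
move=> AB; have [uA _] := mulmx1_unit AB.
by rewrite -[invmx A]mulmx1 -AB mulKmx.
Qed.

(* The bordered permutation matrix is invertible, and remains so when u is added
   to the diagonal of its corner, for generic u; the corner then factors as
   d (I - L) with d diagonal and invertible. *)
Lemma linked_regular (R : realFieldType) n k (D : rel 'I_n) (s t : 'I_k -> 'I_n) :
  linked D s t -> exists L : 'M[R]_n,
    [/\ 1%:M - L \in unitmx, forall i j, ~~ D i j -> L i j = 0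
      & \det (mxsub s t (invmx (1%:M - L))) != 0].
Proof.
move=> [g [gi gE]].
have sg_inj : injective (fun x => unsplit (g (split x))).
  move=> x y /(can_inj (@unsplitK n k))/gi; exact: (can_inj (@splitK n k)).
pose M : 'M[R]_(n + k) := perm_mx (perm sg_inj).
have ME x y : M (unsplit x) (unsplit y) = (g x == y)%:R.
  by rewrite !mxE permE unsplitK (inj_eq (can_inj (@unsplitK n k))).
have M0 : \det M != 0 by rewrite det_perm signr_eq0.
clearbody M.
have gs c : g (inr c) = inl (s c).
  by have := gE (inr c); case: (g _) => //= j /eqP->.
have gt c : g (inl (t c)) = inr c.
  have := f_invF gi (inr c); have := gE (invF gi (inr c)).
  by case: (invF _ _) => [j|d]; [move=> + gj; rewrite gj => /eqP<- | rewrite gs].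
pose A := ulsubmx M.
have AE i j : A i j = (g (inl i) == inl j)%:R by rewrite -ME !mxE.
(* The double negation matches the form required by [det_border]. *)
have MA : M = block_mx A (colsub t 1%:M) (- - rowsub s 1%:M) 0.
  rewrite -[M]submxK; congr block_mx; apply/matrixP => i j; rewrite !mxE.
  - rewrite (ME (inl i) (inr j)); congr (nat_of_bool _)%:R.
    case: (i =P t j) => [->|ij]; first by rewrite gt eqxx.
    have := gE (inl i); case: (g _) => //= d /eqP itd.
    by case: eqP => // -[dj]; case: ij; rewrite itd dj.
  - by rewrite opprK (ME (inr i) (inl j)) gs.
  - by rewrite (ME (inr i) (inr j)) gs.
clearbody A.
have [q1 q10 q1E] := det_addr_scalar A.
have [q2 q2E] := det_affine M (block_mx 1%:M 0 0 0).
have q20 : q2 != 0.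
  by apply: contraNneq M0 => q20; have := q2E 0; rewrite scale0r addr0 q20 horner0 => ->.
have [u /andP[u0 _]] := poly_nonroot (mulf_neq0 q10 q20) ltr01.
rewrite hornerM mulf_eq0 negb_or => /andP[]; rewrite -q1E -q2E.
set N := A + _ => N0; have uN : N \in unitmx by rewrite unitmxE unitfE.
have -> : M + u *: block_mx 1%:M 0 0 0 =
    block_mx N (colsub t 1%:M) (- - rowsub s 1%:M) 0.
  by rewrite MA scale_block_mx add_block_mx !scaler0 !addr0 scale_scalar_mx mulr1.
rewrite det_border// !mulNmx -mxsub_mulmx -scaleN1r detZ !mulf_eq0 !negb_or => /and3P[_ _ N1].
(* The diagonal entries [A i i + u] of [N] are positive; dividing each row by its own makes [L]
   vanish on the diagonal. *)
pose d := \row_i (A i i + u).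
have d0 i : d 0 i != 0 by rewrite mxE lt0r_neq0// AE ltr_wpDl.
pose e := \row_i (d 0 i)^-1.
have de : diag_mx e *m diag_mx d = 1%:M.
  rewrite mulmx_diag; apply/matrixP => i j; rewrite !mxE mulVf//.
  by have := d0 i; rewrite mxE.
exists (1%:M - diag_mx e *m N).
have -> : 1%:M - (1%:M - diag_mx e *m N) = diag_mx e *m N by rewrite opprB addrC subrK.
have [uL iL] : diag_mx e *m N \in unitmx /\ invmx (diag_mx e *m N) = invmx N *m diag_mx d.
  by apply: mulmx1_invmx; rewrite -mulmxA mulKVmx.
split => //.
  move=> i j nD; rewrite mul_diag_mx !mxE; case: (eqVneq i j) => [<-|ij] /=.
    by rewrite mulVf ?subrr//; have := d0 i; rewrite mxE.
  rewrite (AE i j); case: eqP => [gij|_]; last by rewrite /= !mulr0n addr0 mulr0 subr0.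
  by have := gE (inl i); rewrite gij /= (negPf ij) (negPf nD).
have -> : mxsub s t (invmx (diag_mx e *m N)) =
    mxsub s t (invmx N) *m diag_mx (\row_c d 0 (t c)).
  by rewrite iL !mul_mx_diag; apply/matrixP => i j; rewrite !mxE.
rewrite det_mulmx det_diag mulf_neq0//.
by apply/prodf_neq0 => c _; rewrite mxE.
Qed.

(** No edge leaves the primed side, so every path crosses over exactly once; [lf] and [rf] list the
    two ends of the crossing edges. *)
Lemma linked_flow_graph_split n k (D B : rel 'I_n) (s t : 'I_k -> 'I_n) :
  linked (flow_graph D B) (inl \o s) (inr \o t) ->
  exists lf rf : 'I_k -> 'I_n,
    [/\ linked (fun x y => D y x) s lf, linked D rf t
      & forall c, lf c = rf c \/ B (lf c) (rf c)].
Proof.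
move=> [g [gi gE]].
have gs c : g (inr c) = inl (inl (s c)).
  by have := gE (inr c); case: (g _) => //= j /eqP->.
pose L := [set i | if g (inl (inl i)) is inl (inr _) then true else false].
have cL : #|L| = k.
  pose A := [set (inl (inl j) : ('I_n + 'I_n) + 'I_k) | j : 'I_n].
  have cA : #|A| = n by rewrite card_imset ?card_ord// => x y [].
  have := card_preimset A gi; rewrite cA.
  (* Unprimed vertices are reached from the non-crossing unprimed ones and from the [k] markers, so
     [n = (n - #|L|) + k]. *)
  have -> : g @^-1: A = [set inl (inl j) | j in ~: L] :|: [set inr c | c : 'I_k].
    apply/setP => x; rewrite !inE; apply/imsetP/orP => [[j _ gx]|].
      case: x gx => [[i|i]|c] gx.
      - by left; apply/imsetP; exists i; rewrite // !inE gx.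
      - by have := gE (inl (inr i)); rewrite gx.
      - by right; apply/imsetP; exists c.
    case=> /imsetP[i iL ->]; last by exists (s i).
    move: iL; rewrite !inE; have := gE (inl (inl i)).
    by case: (g _) => [[j|j]|c] //=; exists j.
  have disj : [disjoint [set (inl (inl j) : ('I_n + 'I_n) + 'I_k) | j in ~: L]
                & [set inr c | c : 'I_k]].
    apply/pred0P => x /=; apply/negbTE/negP => /andP[/imsetP[i _ ->]].
    by move=> /imsetP[].
  rewrite cardsU disjoint_setI0// cards0 subn0 !card_imset; last 2 first.
  - by move=> x y [].
  - by move=> x y [].
  by rewrite card_ord; have := cardsC L; rewrite card_ord; lia.
pose lf (c : 'I_k) := enum_val (cast_ord (esym cL) c).
have lf_inj : injective lf by move=> c d /enum_val_inj/cast_ord_inj.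
have lfL c : lf c \in L by apply: enum_valP.
have Llf i : i \in L -> exists c, lf c = i.
  move=> iL; exists (cast_ord cL (enum_rank_in iL i)).
  by rewrite /lf cast_ordK enum_rankK_in.
pose rf c := if g (inl (inl (lf c))) is inl (inr j) then j else lf c.
have grf c : g (inl (inl (lf c))) = inl (inr (rf c)).
  by rewrite /rf; have := lfL c; rewrite inE; case: (g _) => [[]|].
exists lf, rf; split; last first.
- move=> c; have := gE (inl (inl (lf c))); rewrite grf /= => /orP[/eqP|]; [by left|by right].
(* Right half: [g] on primed vertices, with marker [c] entering at [rf c]; the branch returning to
   the unprimed side never occurs. *)
- pose g2 (x : 'I_n + 'I_k) : 'I_n + 'I_k := match x with
    | inl i => match g (inl (inr i)) with inr b => inr b | inl (inr j) => inl j | inl (inl j) => inl j end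
    | inr c => inl (rf c) end.
  have g2E i : match g2 (inl i) with
      | inl j => g (inl (inr i)) = inl (inr j)
      | inr c => g (inl (inr i)) = inr c end.
    by rewrite /g2; have := gE (inl (inr i)); case: (g _) => [[]|].
  exists g2; split.
    move=> [i|c] [j|d].
    - have := g2E i; have := g2E j; case: (g2 _) => x ei; case: (g2 _) => y ej // [xy];
      by move: ei; rewrite -xy -ej => /gi[->].
    - by have := g2E i; case: (g2 _) => x ex //= [xd]; move: ex; rewrite xd -grf => /gi.
    - by have := g2E j; case: (g2 _) => x ex //= [xd]; move: ex; rewrite -xd -grf => /gi.
    - by move=> /= [rcd]; have := grf c; rewrite rcd -grf => /gi[/lf_inj->].
  move=> [i|c] /=; last by rewrite eqxx.
  by have := g2E i; have := gE (inl (inr i)); rewrite /= => + gx;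
    move: gx; rewrite /g2; case: (g _) => [[]|].
(* Left half: [g] on unprimed vertices, with [lf c] now ending at marker [c]; the default [inl i] is
   never reached. *)
- pose g1 (x : 'I_n + 'I_k) : 'I_n + 'I_k := match x with
    | inl i => match g (inl (inl i)) with
               | inl (inl j) => inl j
               | _ => if [pick c | lf c == i] is Some c then inr c else inl i end
    | inr c => inl (s c) end.
  have g1E i : match g1 (inl i) with
      | inl j => g (inl (inl i)) = inl (inl j)
      | inr c => lf c = i end.
    rewrite /g1; have := gE (inl (inl i)); case gx: (g _) => [[x|x]|x] //= _.
    case: pickP => [c /eqP//|none].
    have [|c lc] := Llf i; first by rewrite inE gx.
    by have := none c; rewrite lc eqxx.
  exists g1; split.
    move=> [i|c] [j|d].
    - have := g1E i; have := g1E j; case: (g1 _) => x ei; case: (g1 _) => y ej // [xy].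
        by move: ei; rewrite -xy -ej => /gi[->].
      by rewrite -ei -ej xy.
    - by have := g1E i; case: (g1 _) => x ex //= [xd]; move: ex; rewrite xd -gs => /gi.
    - by have := g1E j; case: (g1 _) => x ex //= [xd]; move: ex; rewrite -xd -gs => /gi.
    - by move=> /= [scd]; have := gs c; rewrite scd -gs => /gi[->].
  move=> [i|c]; last by rewrite /= eqxx.
  have := g1E i; case: (g1 _) => [j gi'|c <-] /=; last by rewrite eqxx.
  by have := gE (inl (inl i)); rewrite gi'.
Qed.

(** The shift by [e] makes the semidefinite Gram matrix definite and leaves its off-diagonal support
    alone. *)
Lemma pos_def_gram (R : realType) n k (C : 'M[R]_(k, n)) (e : R) :
  0 < e -> pos_def (C^T *m C + e%:M).
Proof.
move=> e0; split.
  by rewrite linearD /= trmx_mul trmxK tr_scalar_mx.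
have sq m (y : 'cV[R]_m) : (y^T *m y) 0 0 = \sum_i y i 0 ^+ 2.
  by rewrite mxE; apply: eq_bigr => i _; rewrite mxE expr2.
move=> x x0.
have -> : x^T *m (C^T *m C + e%:M) *m x = (C *m x)^T *m (C *m x) + e *: (x^T *m x).
  by rewrite mulmxDr mulmxDl mul_mx_scalar -scalemxAl trmx_mul !mulmxA.
rewrite mxE [X in _ + X]mxE !sq ltr_wpDl ?sumr_ge0// => [i _|]; first exact: sqr_ge0.
rewrite mulr_gt0// lt0r sumr_ge0 ?andbT => [|i _]; last exact: sqr_ge0.
apply: contraNneq x0 => /eqP; rewrite psumr_eq0 => [/allP x0|i _]; last exact: sqr_ge0.
apply/eqP/matrixP => i j; rewrite ord1 mxE; apply/eqP.
by rewrite -sqrf_eq0; have := x0 i; rewrite mem_index_enum => /(_ isT).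
Qed.

(* Along a segment of matrices L the tops of the paths move from the left ends
   lf to the right ends rf: Omega = C^T C has minor
   det(C P_S)^T det(C P_T), whose two factors are controlled separately. *)
Lemma linked_sigma_minor (R : realType) n k (D B : rel 'I_n) (s t : 'I_k -> 'I_n) :
  (forall i j, B i j = B j i) ->
  linked (flow_graph D B) (inl \o s) (inr \o t) ->
  exists2 th : 'M[R]_n * 'M[R]_n, in_Theta D B th & \det (mxsub s t (phi th)) != 0.
Proof.
move=> Bsym /linked_flow_graph_split[lf [rf [lk1 lk2 lr]]].
have [L1' [u1' D1' d1']] := linked_regular R lk1.
have [L2 [u2 D2 d2]] := linked_regular R lk2.
(* The left paths run against the edges, so the matrix found for the reversed graph is transposed
   back. *)
pose L1 := L1'^T.
have L1E : 1%:M - L1 = (1%:M - L1')^T by rewrite linearB /= trmx1.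
have u1 : 1%:M - L1 \in unitmx by rewrite L1E unitmx_tr.
have D1 i j : ~~ D i j -> L1 i j = 0 by move=> nD; rewrite mxE D1'.
have d1 : \det (mxsub lf s (invmx (1%:M - L1))) != 0.
  by rewrite L1E -trmx_inv -det_tr; move: d1'; congr (\det _ != 0); apply/matrixP => i j; rewrite !mxE.
clearbody L1.
(* The left minor is nonzero at [u = 0] and the right one at [u = 1]; once bordered, both are
   polynomials in [u], so a single [u] serves both. *)
pose Lt u := L1 + u *: (L2 - L1).
pose C u : 'M[R]_(k, n) := rowsub lf 1%:M + u *: (rowsub rf 1%:M - rowsub lf 1%:M).
have [q0 q0E] := det_affine (1%:M - L1) (L1 - L2).
have LtE u : 1%:M - Lt u = (1%:M - L1) + u *: (L1 - L2).
  by rewrite /Lt opprD addrA -scalerN opprB.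
have border X : exists q : {poly R}, forall u, 
    \det (block_mx (1%:M - Lt u) X (- C u) 0) = q.[u].
  have [q qE] := det_affine (block_mx (1%:M - L1) X (- rowsub lf 1%:M) 0)
    (block_mx (L1 - L2) 0 (- (rowsub rf 1%:M - rowsub lf 1%:M)) 0).
  exists q => u; rewrite -qE scale_block_mx add_block_mx !scaler0 !addr0 LtE.
  by rewrite /C opprD scalerN.
have [q1 q1E] := border (colsub s 1%:M).
have [q2 q2E] := border (colsub t 1%:M).
have Lt0 : Lt 0 = L1 by rewrite /Lt scale0r addr0.
have Lt1 : Lt 1 = L2 by rewrite /Lt scale1r addrC subrK.
have C0 : C 0 = rowsub lf 1%:M by rewrite /C scale0r addr0.
have C1 : C 1 = rowsub rf 1%:M by rewrite /C scale1r addrC subrK.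
have nz (q : {poly R}) u : q.[u] != 0 -> q != 0.
  by apply: contraNneq => ->; rewrite horner0.
have q00 : q0 != 0 by apply: (nz _ 0); rewrite -q0E scale0r addr0 -unitfE -unitmxE.
have q10 : q1 != 0.
  apply: (nz _ 0); rewrite -q1E Lt0 C0 det_border// -mxsub_mulmx mulf_neq0//.
  by rewrite -unitfE -unitmxE.
have q20 : q2 != 0.
  apply: (nz _ 1); rewrite -q2E Lt1 C1 det_border// -mxsub_mulmx mulf_neq0//.
  by rewrite -unitfE -unitmxE.
have [u _] := poly_nonroot (mulf_neq0 q00 (mulf_neq0 q10 q20)) ltr01.
rewrite !hornerM !mulf_eq0 !negb_or -q0E -LtE -q1E -q2E => /and3P[e0 e1 e2].
have uL : 1%:M - Lt u \in unitmx by rewrite unitmxE unitfE.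
set P := invmx (1%:M - Lt u).
rewrite det_border// mulf_eq0 negb_or e0 /= -/P in e1.
rewrite det_border// mulf_eq0 negb_or e0 /= -/P in e2.
(* The minor is a polynomial in the shift [e]; at [e = 0] it is the product of the left and right
   minors. *)
have [q qE] := det_affine (mxsub s t (P^T *m ((C u)^T *m C u) *m P)) (mxsub s t (P^T *m P)).
have q_0 : q != 0.
  apply: (nz _ 0); rewrite -qE scale0r addr0 mxsub_mulmx.
  have -> : rowsub s 1%:M *m (P^T *m ((C u)^T *m C u) *m P) *m colsub t 1%:M =
     (C u *m P *m colsub s 1%:M)^T *m (C u *m P *m colsub t 1%:M).
    have -> : rowsub s 1%:M = (colsub s 1%:M : 'M[R]_(_, k))^T.
      by apply/matrixP => i j; rewrite !mxE eq_sym.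
    by rewrite !trmx_mul !mulmxA.
  by rewrite det_mulmx det_tr mulf_neq0.
have [e /andP[e_gt0 _]] := poly_nonroot q_0 ltr01.
rewrite -qE => de.
exists (Lt u, (C u)^T *m C u + e%:M).
  split; split => //=.
  - by move=> i j nD; rewrite !mxE D1 ?D2// oppr0 addr0 mulr0 addr0.
  - exact: pos_def_gram.
  - move=> i j ij nB; rewrite !mxE (negPf ij) addr0 big1// => c _; rewrite !mxE.
    (* Row [c] of [C u] is supported on [lf c] and [rf c], which coincide or are joined in [B];
       hence the off-diagonal support of Omega lies in [B]. *)
    have Cij a : lf c != a -> rf c != a -> (lf c == a)%:R + u * ((rf c == a)%:R - (lf c == a)%:R) = 0.
      by move=> /negPf-> /negPf->; rewrite subrr mulr0 addr0.
    have nlr : ~ ((lf c = i /\ rf c = j) \/ (lf c = j /\ rf c = i)).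
      case: (lr c) => [->|Bc] [[li ri]|[li ri]].
      - by move: ij; rewrite -li -ri eqxx.
      - by move: ij; rewrite -li -ri eqxx.
      - by move: nB; rewrite -li -ri Bc.
      - by move: nB; rewrite -li -ri Bsym Bc.
    case: (boolP ((lf c != i) && (rf c != i))) => [/andP[li ri]|].
      by rewrite (Cij i)// mul0r.
    move=> h; rewrite (Cij j) ?mulr0//; apply/eqP => cj.
      case/nandP: h => /negPn/eqP ci.
        by move: ij; rewrite -ci -cj eqxx.
      by apply: nlr; right.
    case/nandP: h => /negPn/eqP ci; first by apply: nlr; left.
    by move: ij; rewrite -ci -cj eqxx.
move: de; congr (\det _ != 0).
rewrite /phi /= -/P; move: (C u) (P) => Cu P0; rewrite mulmxDr mulmxDl mul_mx_scalar -scalemxAl.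
by apply/matrixP => i j; rewrite !mxE.
Qed.

(** * Reachability, the inverse of [1%:M - L], and edge deletion *)

Section PathMatrix.
Variables (F : fieldType) (n : nat) (D : rel 'I_n) (L : 'M[F]_n).
Hypotheses (uL : 1%:M - L \in unitmx) (LD : forall i j, ~~ D i j -> L i j = 0).

(* The row vectors supported on the vertices reachable from v form a subspace
   stable under the invertible matrix I - L, hence also under its inverse. *)
Lemma invmx_connect v u : invmx (1%:M - L) v u != 0 -> connect D v u.
Proof.
pose Q : 'M[F]_n := diag_mx (\row_i (connect D v i)%:R).
have QL : Q *m (1%:M - L) = Q *m (1%:M - L) *m Q.
  apply/matrixP => i j; rewrite [RHS](_ : _ = (Q *m (1%:M - L)) i j * (connect D v j)%:R).
    rewrite mul_diag_mx !mxE; case: (boolP (connect D v i)) => vi; rewrite ?mul0r// mul1r.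
    case: (boolP (connect D v j)) => vj; rewrite ?mulr1// mulr0.
    case: (eqVneq i j) vj => [<-|_ vj]; first by rewrite vi.
    rewrite LD ?subrr//; apply: contraNN vj => ij.
    exact: connect_trans vi (connect1 ij).
  by rewrite mul_mx_diag !mxE.
(* Equality of ranks reverses the inclusion of row spaces given by [QL]. *)
have subQ : (Q <= Q *m (1%:M - L))%MS.
  rewrite -(geq_leqif (mxrank_leqif_sup _)); last by rewrite QL submxMl.
  by rewrite mxrankMfree// row_free_unit.
have [y yQ] : exists y, row v Q = y *m (Q *m (1%:M - L)).
  by apply/submxP; apply: submx_trans subQ; apply: row_sub.
have rP : row v (invmx (1%:M - L)) = y *m Q.
  have -> : row v (invmx (1%:M - L)) = row v Q *m invmx (1%:M - L).
    rewrite -row_mul mul_diag_mx; apply/rowP => j; rewrite !mxE connect0 mul1r//.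
  by rewrite yQ mulmxA mulmxK.
apply: contraR => vu; have := congr1 (fun A : 'rV_n => A 0 u) rP.
by rewrite mul_mx_diag !mxE (negPf vu) mulr0 => ->.
Qed.

Lemma invmx_not_des v u : u != v -> u \notin des D v -> invmx (1%:M - L) v u = 0.
Proof.
move=> uv; apply: contraNeq => /invmx_connect /connectP[[|w p] /=].
  by move=> _ /eqP; rewrite (negPf uv).
move=> /andP[vw wp] ul; rewrite inE; apply/existsP; exists w.
by rewrite vw; apply/connectP; exists p.
Qed.

(** A path from [v] to [w], closed by the edge into [v], would put [v] on a directed cycle. *)
Lemma invmx_in_edge v w : v \notin des D v -> D w v -> invmx (1%:M - L) v w = 0.
Proof.
move=> vv wv; apply: contraNeq vv => /invmx_connect /connectP[[|x p] /=].
  by move=> _ wE; rewrite wE in wv; rewrite inE; apply/existsP; exists v; rewrite connect0 wv.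
move=> /andP[vx xp] wl; rewrite inE; apply/existsP; exists x; rewrite vx.
by apply: (@connect_trans _ _ w); [apply/connectP; exists p | apply: connect1].
Qed.

Lemma invmx_diag v : v \notin des D v -> invmx (1%:M - L) v v = 1.
Proof.
move=> vv; have := mulVmx uL; rewrite mulmxBr mulmx1 => /matrixP/(_ v v).
rewrite !mxE eqxx big1 ?subr0// => w _.
case: (boolP (D w v)) => [wv|/LD->]; last by rewrite mulr0.
by rewrite invmx_in_edge// mul0r.
Qed.

Variables (O : 'M[F]_n) (v : 'I_n) (c : 'I_n -> F).
Hypotheses (cD : forall w, ~~ D w v -> c w = 0) (vv : v \notin des D v).

Let Lbar : 'M[F]_n := \matrix_(i, j) (L i j - c i * (j == v)%:R).

(** Changing the weights of edges into [v] is a rank-one update of [1%:M - L]. As [v] lies on no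
    cycle, [r *m cv = 0], and the new inverse is simply [P *m M]. *)
Lemma sigma_remove_edges :
  1%:M - Lbar \in unitmx /\
  forall i j, i != v -> i \notin des D v ->
    sigma Lbar O i j = sigma L O i j
      - (\sum_w c w * sigma L O i w) * invmx (1%:M - L) v j.
Proof.
set P := invmx (1%:M - L); pose cv : 'cV[F]_n := \col_w c w.
pose r := row v P; pose M : 'M_n := 1%:M - cv *m r.
have rc : r *m cv = 0.
  apply/matrixP => a b; rewrite !mxE big1// => w _; rewrite !mxE.
  case: (boolP (D w v)) => [wv|/cD->]; last by rewrite mulr0.
  by rewrite /P invmx_in_edge// mul0r.
have LbarE : 1%:M - Lbar = (1%:M - L) + cv *m (delta_mx 0 v : 'rV_n).
  apply/matrixP => a b; rewrite !mxE big_ord1 !mxE eqxx /=; ring.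
have inv : (1%:M - Lbar) *m (P *m M) = 1%:M.
  rewrite mulmxA LbarE mulmxDl mulmxV// -mulmxA -rowE -/r.
  rewrite /M mulmxBr mulmx1 mulmxDl mul1mx -[_ *m (cv *m r)]mulmxA (mulmxA r) rc mul0mx.
  by rewrite mulmx0 addr0 addrK.
have [uLb iLb] := mulmx1_invmx inv; split => // i j iv idv.
have ri : P v i = 0 by apply: invmx_not_des.
have -> : sigma Lbar O = M^T *m sigma L O *m M.
  by rewrite /sigma iLb trmx_mul !mulmxA.
have ME a b : M a b = (a == b)%:R - c a * P v b.
  by rewrite !mxE big_ord1 !mxE.
(* As [P v i = 0], the left factor [M^T] does not alter row [i]. *)
have rowi b : (M^T *m sigma L O) i b = sigma L O i b.
  rewrite mxE (bigD1 i)//= mxE ME ri eqxx mulr0 subr0 mul1r big1 ?addr0// => a ai.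
  by rewrite mxE ME ri (negPf ai) mulr0 subr0 mul0r.
rewrite mxE; under eq_bigr do rewrite rowi ME mulrBr.
rewrite sumrB (bigD1 j)//= eqxx mulr1 [X in _ + X - _]big1 ?addr0; last first.
  by move=> a /negPf->; rewrite mulr0.
by rewrite mulr_suml; congr (_ - _); apply: eq_bigr => w _; rewrite mulrCA mulrA.
Qed.
End PathMatrix.

(** * Minors as linear functions of their last column *)

Section LastColumn.
Variables (R : realType) (n : nat) (x0 : 'I_n) (rs ts : seq 'I_n).
Hypothesis size_rs : size rs = (size ts).+1.

(** The cofactors of the last column see only rows [rs] and columns [ts], so they serve every [x]
    and every matrix agreeing there; the [x0] put in that column is immaterial. *)
Lemma subdet_last_col (A : 'M[R]_n) : exists cof : 'I_(size rs) -> R,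
  forall (A' : 'M[R]_n) x, (forall i j, i \in rs -> j \in ts -> A' i j = A i j) ->
    subdet A' x0 rs (rcons ts x) = \sum_(i < size rs) A' (nth x0 rs i) x * cof i.
Proof.
have lt : (size ts < size rs)%N by rewrite size_rs.
pose j0 := Ordinal lt.
pose M (A' : 'M[R]_n) x : 'M_(size rs) :=
  \matrix_(i, j) A' (nth x0 rs i) (nth x0 (rcons ts x) j).
exists (fun i => cofactor (M A x0) i j0) => A' x A'A.
rewrite /subdet -/(M A' x) (expand_det_col _ j0); apply: eq_bigr => i _.
rewrite mxE nth_rcons ltnn eqxx; congr (_ * (_ * \det _)).
apply/matrixP => a b; rewrite !mxE !nth_rcons.
have bt : (lift j0 b < size ts)%N.
  have := ltn_ord (lift j0 b); have : lift j0 b != size ts :> nat.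
    by rewrite -[size ts]/(val j0) val_eqE eq_sym neq_lift.
  by move: (nat_of_ord _) => m; rewrite [X in (_ < X)%N]size_rs; lia.
by rewrite bt A'A// mem_nth.
Qed.
End LastColumn.

(** * Generic properties on the parameter space *)

Lemma meval_line (R : comNzRingType) m (f : {mpoly R[m]}) (x y : 'I_m -> R) :
  exists p : {poly R}, forall u, f.@[fun i => x i + u * y i] = p.[u].
Proof.
exists (mmap polyC (fun i => (x i)%:P + 'X * (y i)%:P) f) => u.
rewrite mevalE /mmap horner_sum; apply: eq_bigr => a _.
rewrite hornerM hornerC /mmap1 horner_prod; congr (_ * _); apply: eq_bigr => i _.
by rewrite horner_exp !hornerE.
Qed.

Lemma meval_minor (R : comNzRingType) m n k (M : 'M[{mpoly R[m]}]_n) (s t : 'I_k -> 'I_n)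
    (x : 'I_m -> R) :
  (\det (mxsub s t M)).@[x] = \det (mxsub s t (map_mx (meval x) M)).
Proof.
by rewrite -det_map_mx; congr (\det _); apply/matrixP => i j; rewrite !mxE.
Qed.

Section Generic.
Variables (R : realType) (n : nat) (D B : rel 'I_n).
Implicit Types (P Q : 'M[R]_n * 'M[R]_n -> Prop) (th : 'M[R]_n * 'M[R]_n).

Lemma pos_def_segment (O1 O2 : 'M[R]_n) u : 0 < u < 1 -> pos_def O1 -> pos_def O2 ->
  pos_def (O1 + u *: (O2 - O1)).
Proof.
move=> /andP[u0 u1] [s1 p1] [s2 p2]; split.
  by rewrite linearD /= linearZ /= linearB /= s1 s2.
move=> x x0; have := p1 x x0; have := p2 x x0.
have -> : x^T *m (O1 + u *: (O2 - O1)) *m x =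
    (1 - u) *: (x^T *m O1 *m x) + u *: (x^T *m O2 *m x).
  rewrite mulmxDr -scalemxAr mulmxBr mulmxDl -scalemxAl mulmxBl.
  by rewrite scalerBl scale1r scalerBr addrAC addrA.
have -> (a b : R) (A C : 'M[R]_1) : (a *: A + b *: C) 0 0 = a * A 0 0 + b * C 0 0.
  by rewrite !mxE.
move=> h2 h1; by rewrite addr_gt0// mulr_gt0// subr_gt0.
Qed.

Lemma param_coords_line th1 th2 u i :
  param_coords (th1.1 + u *: (th2.1 - th1.1), th1.2 + u *: (th2.2 - th1.2)) i =
  param_coords th1 i + u * (param_coords th2 i - param_coords th1 i).
Proof.
by rewrite /param_coords; case: (split i) => a /=; rewrite linearD /= linearZ /= linearB /= !mxE.
Qed.

Lemma genericallyW P Q : (forall th, in_Theta D B th -> P th -> Q th) ->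
  generically D B P -> generically D B Q.
Proof. by move=> PQ [fs [pfs h]]; exists fs; split => // th t1 t2; apply/PQ/h. Qed.

Lemma generically_neq0 (f : {mpoly R[n * n + n * n]}) th P : in_Theta D B th ->
  f.@[param_coords th] != 0 ->
  (forall th', in_Theta D B th' -> f.@[param_coords th'] != 0 -> P th') ->
  generically D B P.
Proof.
move=> thT f0 fP; exists [:: f]; split.
  by exists th; split => // -[_ /=]; rewrite andbT (negPf f0).
move=> th' thT' nf; apply: fP => //; apply/negP => f'0.
by apply: nf; split; rewrite //= f'0.
Qed.

(** A point outside the subset is a non-zero of some [f] in [fs], and the zero set of [f] contains
    the subset. *)
Lemma generically_witness P : generically D B P ->
  exists f : {mpoly R[n * n + n * n]},
    (exists2 th, in_Theta D B th & f.@[param_coords th] != 0) /\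
    (forall th, in_Theta D B th -> f.@[param_coords th] != 0 -> P th).
Proof.
move=> [fs [[th [thT nfs]] h]].
have /allPn[f ffs f0] : ~~ all (fun f : {mpoly R[_]} => f.@[param_coords th] == 0) fs.
  by apply/negP => a; apply: nfs.
exists f; split; first by exists th.
move=> th' thT' f'0; apply: h => // -[_ /allP/(_ f ffs)].
by rewrite (negPf f'0).
Qed.

(* Theta is irreducible: two points where f and g do not vanish are joined by a
   segment, on which f, g and det(I - L) have finitely many zeros. *)
Lemma generically_and P Q : generically D B P -> generically D B Q ->
  generically D B (fun th => P th /\ Q th).
Proof.
move=> /generically_witness[f [[th1 T1 f1] fP]] /generically_witness[g [[th2 T2 g2] gQ]].
pose th u := (th1.1 + u *: (th2.1 - th1.1), th1.2 + u *: (th2.2 - th1.2)).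
have line (h : {mpoly R[n * n + n * n]}) :
    exists p : {poly R}, forall u, h.@[param_coords (th u)] = p.[u].
  have [p pE] := meval_line h (param_coords th1) (fun i => param_coords th2 i - param_coords th1 i).
  by exists p => u; rewrite -pE; apply: meval_eq => i; rewrite param_coords_line.
have th_0 : th 0 = th1 by rewrite /th !scale0r !addr0; case: (th1).
have th_1 : th 1 = th2 by rewrite /th !scale1r ![_ + (_ - _)]addrC !subrK; case: (th2).
have nz (q : {poly R}) u : q.[u] != 0 -> q != 0.
  by apply: contraNneq => ->; rewrite horner0.
have [p pE] := line f; have [q qE] := line g.
have [d dE] := det_affine (1%:M - th1.1) (th1.1 - th2.1).
have thE u : 1%:M - (th u).1 = (1%:M - th1.1) + u *: (th1.1 - th2.1).
  by rewrite /th /= opprD addrA -scalerN opprB.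
have p0 : p != 0 by apply: (nz _ 0); rewrite -pE th_0.
have q0 : q != 0 by apply: (nz _ 1); rewrite -qE th_1.
have d0 : d != 0.
  apply: (nz _ 0); rewrite -dE scale0r addr0 -unitfE -unitmxE.
  by case: T1 => -[].
have [u u01] := poly_nonroot (mulf_neq0 d0 (mulf_neq0 p0 q0)) ltr01.
rewrite !hornerM !mulf_eq0 !negb_or -dE -pE -qE -thE => /and3P[du fu gu].
have Tu : in_Theta D B (th u).
  case: T1 T2 => -[L1 _] [pd1 O1] [[L2 _] [pd2 O2]]; split; split.
  - by move=> i j nD; rewrite !mxE L1// L2// subrr mulr0 addr0.
  - by rewrite unitmxE unitfE.
  - exact: pos_def_segment.
  - by move=> i j ij nB; rewrite !mxE O1// O2// subrr mulr0 addr0.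
apply: (@generically_neq0 (f * g) (th u)) => //.
  by rewrite mevalM mulf_neq0.
move=> th' T'; rewrite mevalM mulf_eq0 negb_or => /andP[f' g'].
by split; [apply: fP | apply: gQ].
Qed.

Lemma generically_all (I : finType) (P : I -> 'M[R]_n * 'M[R]_n -> Prop) :
  (exists th : 'M[R]_n * 'M[R]_n, in_Theta D B th) -> (forall i, generically D B (P i)) ->
  generically D B (fun th => forall i, P i th).
Proof.
move=> [th0 T0] gP.
suff gs (r : seq I) : generically D B (fun th => forall i, i \in r -> P i th).
  by apply: genericallyW (gs (enum I)) => th _ h i; apply: h; rewrite mem_enum.
elim: r => [|i r IH].
  by apply: (@generically_neq0 1 th0) => //; rewrite meval1 oner_neq0.
apply: genericallyW (generically_and (gP i) IH) => th _ [Pi Pr] j.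
by rewrite inE => /predU1P[->|/Pr].
Qed.

Lemma generically_minor k (s t : 'I_k -> 'I_n) th :
  in_Theta D B th -> \det (mxsub s t (phi th)) != 0 ->
  generically D B (fun th => \det (mxsub s t (phi th)) != 0).
Proof.
move=> thT th0.
pose VL : 'M[{mpoly R[n * n + n * n]}]_n :=
  \matrix_(i, j) 'X_(lshift (n * n) (mxvec_index i j)).
pose VO : 'M[{mpoly R[n * n + n * n]}]_n :=
  \matrix_(i, j) 'X_(rshift (n * n) (mxvec_index i j)).
(* Adjugates instead of inverses make the entries polynomial; Sigma is thereby scaled by
   [\det (1%:M - L) ^+ 2], nonzero on Theta. *)
pose M := (\adj (1%:M - VL))^T *m VO *m \adj (1%:M - VL).
have ME th' : in_Theta D B th' -> 
    ((\det (mxsub s t M)).@[param_coords th'] == 0) = (\det (mxsub s t (phi th')) == 0).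
  move=> [[_ uL] _]; rewrite meval_minor.
  have VLE : map_mx (meval (param_coords th')) VL = th'.1.
    by apply/matrixP => i j; rewrite !mxE mevalXU /param_coords (unsplitK (inl _)) mxvecE.
  have VOE : map_mx (meval (param_coords th')) VO = th'.2.
    by apply/matrixP => i j; rewrite !mxE mevalXU /param_coords (unsplitK (inr _)) mxvecE.
  have -> : map_mx (meval (param_coords th')) M = (\det (1%:M - th'.1) ^+ 2) *: phi th'.
    rewrite /M !map_mxM /= -map_trmx map_mx_adj map_mxB map_mx1 VLE VOE /phi.
    have -> : \adj (1%:M - th'.1) = \det (1%:M - th'.1) *: invmx (1%:M - th'.1).
      by rewrite /invmx uL scalerA mulfV ?scale1r// -unitfE -unitmxE.
    by rewrite -scalemxAr [_^T]linearZ /= -!scalemxAl scalerA expr2.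
  have -> : mxsub s t (\det (1%:M - th'.1) ^+ 2 *: phi th') =
      \det (1%:M - th'.1) ^+ 2 *: mxsub s t (phi th').
    by apply/matrixP => i j; rewrite !mxE.
  rewrite detZ mulf_eq0 !expf_eq0 -[\det (1%:M - th'.1) == 0]negbK -unitfE -unitmxE uL.
  by rewrite !andbF.
apply: (@generically_neq0 (\det (mxsub s t M)) th) => // [|th' T']; by rewrite ME.
Qed.
End Generic.

(** * From flow values to minors of Sigma and back *)

Section SubdeterminantFlow.
Variables (R : realType) (n : nat) (v : 'I_n) (rs cs : seq 'I_n).
Hypotheses (rs_uniq : uniq rs) (cs_uniq : uniq cs) (size_cs : size cs = size rs).

Let s (i : 'I_(size rs)) := nth v rs i.
Let t (i : 'I_(size rs)) := nth v cs i.

Let Src : {set 'I_n + 'I_n} := [set inl x | x in [set i in rs]].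
Let Snk : {set 'I_n + 'I_n} := prime_set [set i in cs].

Let SrcE : [set (inl \o s) x | x : 'I_(size rs)] = Src.
Proof.
apply/setP => x; apply/imsetP/imsetP => [[j _ ->]|[i + ->]].
  by exists (s j); rewrite // inE mem_nth.
by rewrite inE => /(nthP v)[j js <-]; exists (Ordinal js).
Qed.

Let SnkE : [set (inr \o t) x | x : 'I_(size rs)] = Snk.
Proof.
apply/setP => x; apply/imsetP/imsetP => [[j _ ->]|[i + ->]].
  by exists (t j); rewrite // inE mem_nth// size_cs.
by rewrite inE => /(nthP v)[j]; rewrite size_cs => js <-; exists (Ordinal js).
Qed.

Let s_inj : injective (inl \o s : 'I_(size rs) -> 'I_n + 'I_n).
Proof. by move=> i j [] /eqP; rewrite nth_uniq// => /eqP/val_inj. Qed.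

Let t_inj : injective (inr \o t : 'I_(size rs) -> 'I_n + 'I_n).
Proof. by move=> i j [] /eqP; rewrite nth_uniq ?size_cs// => /eqP/val_inj. Qed.

Lemma subdet_neq0_flow (D B : rel 'I_n) (L O : 'M[R]_n) :
  1%:M - L \in unitmx -> (forall i j, ~~ D i j -> L i j = 0) ->
  (forall i j, i != j -> ~~ B i j -> O i j = 0) ->
  subdet (sigma L O) v rs cs != 0 ->
  exists f a b, is_flow (R := R) (flow_graph D B) Src Snk f a b /\
    flow_value Src a = (size rs)%:R.
Proof.
move=> uL LD OB d0; rewrite -SrcE -SnkE -[X in X%:R]card_ord.
exact: (linked_flow _ s_inj (sigma_minor_linked (s := s) (t := t) uL LD OB d0)).
Qed.

Lemma flow_generically_subdet (D B : rel 'I_n) : (forall i j, B i j = B j i) ->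
  max_flow_is (flow_graph D B) Src Snk ((size rs)%:R : R) ->
  generically D B (fun th : 'M[R]_n * 'M[R]_n => subdet (phi th) v rs cs != 0).
Proof.
move=> Bsym [[f [a [b [fl val]]]] _].
rewrite -SrcE -SnkE in fl; rewrite -SrcE -[X in X%:R]card_ord in val.
have [th thT th0] := linked_sigma_minor R Bsym (flow_linked s_inj t_inj fl val).
exact: (generically_minor thT th0).
Qed.
End SubdeterminantFlow.

(** * The linear equation for the edge coefficient *)

Section EdgeIdentity.
Variables (R : realType) (n : nat) (D B : rel 'I_n) (v w0 : 'I_n) (l : nat).
Variables (ws : 'I_l -> 'I_n) (S T : {set 'I_n}).
Hypotheses (w0v : D w0 v) (wsv : forall i, D (ws i) v).
Hypotheses (ws_inj : injective ws) (ws_w0 : forall i, ws i != w0).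
Hypotheses (vS : v \notin S) (vT : v \notin T) (ST : #|S| = #|T|.+1).
Hypothesis desv : des D v :&: (S :|: T :|: [set v]) = set0.
Hypothesis small_flow : forall f a b,
  is_flow (R := R) (flow_graph (remove_edges_into D v w0 ws) B)
    [set inl s | s in S] (prime_set (v |: T)) f a b ->
  flow_value [set inl s | s in S] a < #|S|%:R.

Lemma subdet_edge_identity (th : 'M[R]_n * 'M[R]_n) : in_Theta D B th ->
  th.1 w0 v * subdet (phi th) v (enum S) (rcons (enum T) w0) =
  subdet (phi th) v (enum S) (rcons (enum T) v)
  - \sum_(i < l) th.1 (ws i) v * subdet (phi th) v (enum S) (rcons (enum T) (ws i)).
Proof.
case: th => L O [[/= LD uL] [_ OB]].
have ndes x : x \in S :|: T :|: [set v] -> x \notin des D v.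
  by move=> xS; apply/negP => xd; have := in_set0 x; rewrite -desv inE xd xS.
have vv : v \notin des D v by apply: ndes; rewrite !inE eqxx orbT.
have nS x : x \in S -> x != v /\ x \notin des D v.
  by move=> xS; split; [apply: contraNneq vS => <- | apply: ndes; rewrite !inE xS].
have nT x : x \in T -> x != v /\ x \notin des D v.
  by move=> xT; split; [apply: contraNneq vT => <- | apply: ndes; rewrite !inE xT orbT].
(* The weights of the deleted edges, as a function on all vertices. *)
pose c w := (w0 == w)%:R * L w0 v + \sum_(i < l) (ws i == w)%:R * L (ws i) v.
have cD w : ~~ D w v -> c w = 0.
  move=> nw; rewrite /c big1 => [|i _]; case: eqP => [e|_]; rewrite ?mul0r ?addr0//.
    by move: nw; rewrite -e w0v.
  by move: nw; rewrite -e wsv.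
have c0 : c w0 = L w0 v.
  rewrite /c eqxx mul1r big1 ?addr0// => i _.
  by rewrite (negPf (ws_w0 i)) mul0r.
have cs i : c (ws i) = L (ws i) v.
  rewrite /c eq_sym (negPf (ws_w0 i)) mul0r add0r (bigD1 i)//= eqxx mul1r.
  rewrite big1 ?addr0// => j ji.
  by rewrite (inj_eq ws_inj) (negPf ji) mul0r.
have sumc (F : 'I_n -> R) : \sum_w c w * F w = L w0 v * F w0 + \sum_(i < l) L (ws i) v * F (ws i).
  have dirac a x : \sum_w ((a == w)%:R * x) * F w = x * F a.
    rewrite (bigD1 a)//= eqxx mul1r big1 ?addr0// => w.
    by rewrite eq_sym => /negPf->; rewrite !mul0r.
  under eq_bigr do rewrite mulrDl mulr_suml.
  by rewrite big_split/= dirac exchange_big; congr (_ + _); apply: eq_bigr => i _; rewrite dirac.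
set Lbar : 'M[R]_n := \matrix_(i, j) (L i j - c i * (j == v)%:R).
have [uLbar sigE] := sigma_remove_edges uL LD O cD vv; rewrite -/Lbar in uLbar sigE.
have LbarD i j : ~~ remove_edges_into D v w0 ws i j -> Lbar i j = 0.
  rewrite negb_and negbK mxE => /orP[nD|/andP[/eqP-> /orP[/eqP->|/existsP[a /eqP<-]]]].
  - rewrite LD// sub0r; case: eqP => [jv|_]; last by rewrite mulr0 oppr0.
    by rewrite cD ?mul0r ?oppr0// -jv.
  - by rewrite eqxx mulr1 c0 subrr.
  - by rewrite eqxx mulr1 cs subrr.
have sz : size (enum S) = (size (enum T)).+1 by rewrite -!cardE.
have [cof cofE] := subdet_last_col v sz (sigma L O).
(* A nonzero minor would give a flow of value [#|S|] in the smaller graph, against (c). *)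
have : subdet (sigma Lbar O) v (enum S) (rcons (enum T) v) = 0.
  apply/eqP/negPn/negP => d0.
  have szv : size (rcons (enum T) v) = size (enum S) by rewrite size_rcons.
  have [f [a [b []]]] := subdet_neq0_flow (enum_uniq _) szv uLbar LbarD OB d0.
  have -> : [set i in enum S] = S by apply/setP => i; rewrite !inE mem_enum.
  have -> : [set i in rcons (enum T) v] = v |: T.
    by apply/setP => i; rewrite !inE mem_rcons inE mem_enum.
  move=> /small_flow; rewrite -cardE => + e; rewrite e ltxx//.
(* Sigma is unchanged on rows [S] and columns [T], so both minors share the cofactors [cof]. *)
rewrite cofE => [e|i j]; last first.
  rewrite !mem_enum => /nS[iv id] /nT[jv jd].
  by rewrite sigE// (invmx_not_des uL LD jv jd) mulr0 subr0.
rewrite -[phi _]/(sigma L O); apply/eqP; rewrite eq_sym subr_eq -(sumc (fun x => subdet _ v (enum S) (rcons (enum T) x))); apply/eqP.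
under [RHS]eq_bigr do rewrite cofE// mulr_sumr.
rewrite exchange_big cofE//; apply/eqP; rewrite -subr_eq0 -sumrB; apply/eqP; apply: etrans e.
apply: eq_bigr => i _.
have [iv id] : nth v (enum S) i != v /\ nth v (enum S) i \notin des D v.
  by apply: nS; rewrite -mem_enum mem_nth.
rewrite sigE// (invmx_diag uL LD vv) mulr1 mulrBl mulr_suml.
by congr (_ - _); apply: eq_bigr => w _; rewrite mulrA.
Qed.
End EdgeIdentity.

Theorem theorem3p5 (R : realType) (n : nat) (D B : rel 'I_n)
    (v w0 : 'I_n) (l : nat) (ws : 'I_l -> 'I_n) (S T : {set 'I_n}) (k : nat) :
  mixed_graph D B ->
  D w0 v ->
  (forall i, D (ws i) v) ->
  injective ws ->
  (forall i, ws i != w0) ->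
  v \notin S ->
  v \notin T -> w0 \notin T ->
  #|S| = k -> (#|T| + 1)%N = k ->
  (* (a) *)
  des D v :&: (S :|: T :|: [set v]) = set0 ->
  (* (b) *)
  max_flow_is (flow_graph D B) [set inl s | s in S]
    (prime_set (w0 |: T)) (k%:R : R) ->
  (* (c) *)
  (exists m : R, max_flow_is (flow_graph (remove_edges_into D v w0 ws) B)
                   [set inl s | s in S] (prime_set (v |: T)) m /\ m < k%:R) ->
  let formula := fun th : 'M[R]_n * 'M[R]_n =>
    let Sig := phi th in
    subdet Sig v (enum S) (rcons (enum T) w0) != 0 /\
    th.1 w0 v =
      (subdet Sig v (enum S) (rcons (enum T) v)
       - \sum_(i < l) th.1 (ws i) v * subdet Sig v (enum S) (rcons (enum T) (ws i)))
      / subdet Sig v (enum S) (rcons (enum T) w0) in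
  ((forall i, generically_identifiable R D B (ws i) v) ->
     generically_identifiable R D B w0 v /\ generically D B formula) /\
  ((forall i, rationally_identifiable R D B (ws i) v) ->
     rationally_identifiable R D B w0 v /\ generically D B formula).
Proof.
move=> [_ _ Bsym] w0v wsv ws_inj ws_w0 vS vT w0T <- ST desv big_flow [m [[_ small_flow] mS]].
move=> formula.
have sz : size (rcons (enum T) w0) = size (enum S) by rewrite size_rcons -!cardE -ST addn1.
have gen_det : generically D B (fun th : 'M[R]_n * 'M[R]_n =>
    subdet (phi th) v (enum S) (rcons (enum T) w0) != 0).
  apply: flow_generically_subdet => //.
  - exact: enum_uniq.
  - by rewrite rcons_uniq enum_uniq mem_enum w0T.
  - have -> : [set i in enum S] = S by apply/setP => i; rewrite !inE mem_enum.
    have -> : [set i in rcons (enum T) w0] = w0 |: T.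
      by apply/setP => i; rewrite !inE mem_rcons inE mem_enum.
    by rewrite -cardE.
have formulaP th : in_Theta D B th ->
    subdet (phi th) v (enum S) (rcons (enum T) w0) != 0 -> formula th.
  move=> thT th0; split => //.
  have ST' : #|S| = #|T|.+1 by rewrite -ST addn1.
  have small f a b fl := le_lt_trans (small_flow f a b fl) mS.
  by rewrite -(subdet_edge_identity w0v wsv ws_inj ws_w0 vS vT ST' desv small thT) mulfK.
have gen_formula : generically D B formula by apply: genericallyW gen_det.
have witness : exists th : 'M[R]_n * 'M[R]_n, in_Theta D B th.
  by case: gen_det => fs [[th [thT _]] _]; exists th.
split => ident; split => //.
  apply: genericallyW (generically_and gen_det (generically_all witness ident)).
  move=> th thT [th0 eq_ws] th' thT' phiE.
  have [_ ->] := formulaP th thT th0.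
  (* The point [th'] is arbitrary in the fibre; its denominator is nonzero because it depends on
     Sigma alone. *)
  have [|_ ->] := formulaP th' thT'; first by rewrite phiE.
  rewrite phiE; congr ((_ - _) / _); apply: eq_bigr => i _.
  by rewrite (eq_ws i th').
have {ident} [pq pqE] := fin_all_exists ident.
have {pqE} [q qE] := fin_all_exists pqE.
pose VS : 'M[{mpoly R[n * n]}]_n := \matrix_(i, j) 'X_(mxvec_index i j).
pose s (i : 'I_(size (enum S))) := nth v (enum S) i.
pose d x := \det (mxsub s (fun j : 'I_(size (enum S)) => nth v (rcons (enum T) x) j) VS).
have dE x (th : 'M[R]_n * 'M[R]_n) :
    (d x).@[mx_coords (phi th)] = subdet (phi th) v (enum S) (rcons (enum T) x).
  have VSE (A : 'M[R]_n) : map_mx (meval (mx_coords A)) VS = A.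
    by apply/matrixP => i j; rewrite !mxE mevalXU /mx_coords mxvecE.
  by rewrite /d meval_minor VSE.
pose Q : {mpoly R[n * n]} := \prod_j q j.
(* The formula with each known coefficient replaced by [pq i / q i], cleared of fractions by the
   common denominator [Q]. *)
exists (d v * Q - \sum_(i < l) pq i * (\prod_(j < l | j != i) q j) * d (ws i)), (d w0 * Q).
apply: genericallyW (generically_and gen_det (generically_all witness qE)).
move=> th thT [th0 pqth].
have Q0 : Q.@[mx_coords (phi th)] != 0.
  by rewrite rmorph_prod/=; apply/prodf_neq0 => i _; case: (pqth i).
split; first by rewrite mevalM dE mulf_neq0.
have [_ ->] := formulaP th thT th0.
rewrite mevalB !mevalM !dE rmorph_sum/= invfM mulrA mulrAC; congr (_ / _).
rewrite mulrBl mulfK//; congr (_ - _); rewrite mulr_suml; apply: eq_bigr => i _.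
have [qi0 <-] := pqth i.
have QE : Q.@[mx_coords (phi th)] =
    (q i).@[mx_coords (phi th)] * (\prod_(j < l | j != i) q j).@[mx_coords (phi th)].
  by rewrite /Q (bigD1 i) //= mevalM.
have Qi0 : (\prod_(j < l | j != i) q j).@[mx_coords (phi th)] != 0.
  by apply: contraNneq Q0 => Qi0; rewrite QE Qi0 mulr0.
by rewrite !mevalM dE QE; field; rewrite qi0 Qi0.
Qed.
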